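(* Let $A$ be a finite alphabet with at least two letters, and let $F: A^{\mathbb N}\to A^{\mathbb N}$ be a uniform dill map with diameter $\theta$ and local rule $f: A^\theta\to A^*$. Then the following are equivalent: (i) $F$ is surjective; (ii) $F$ is a surjective cellular automaton; (iii) $|f(u)|=1$ for all $u\in A^\theta$, and for all $v\in A^*\setminus\{\lambda\}$, $$\#\,(f^* )^{-1}(v)=(\#A)^{\theta-1}.$$
   Context: An alphabet $A$ is a finite set; $\mathbb N=\{0,1,2,\dots\}$. $A^n$ is the set of words of length $n$ over $A$, $A^*$ the set of all finite words, $\lambda$ the empty word, $|u|$ the length of a word $u$, and $A^{\mathbb N}$ the set of one-sided infinite sequences (configurations). For $x\in A^{\mathbb N}$ or $x$ a finite word, $x_{[i,j)}$ denotes the word $x_i x_{i+1}\cdots x_{j-1}$. $\#S$ denotes the cardinality of a set $S$. A dill map over $A^{\mathbb N}$ is a function $F:A^{\mathbb N}\to A^{\mathbb N}$ for which there exist an integer $\theta>0$ (the diameter) and a map $f:A^\theta\to A^*$ (the local rule) such that for all $x\in A^{\mathbb N}$, $F(x)=f(x_{[0,\theta)})\,f(x_{[1,1+\theta)})\,f(x_{[2,2+\theta)})\cdots$ (infinite concatenation, which is required to be an element of $A^{\mathbb N}$). For a dill map with diameter $\theta$ and local rule $f$, the lower and upper norms of $f$ are $\min\{|f(u)| : u\in A^\theta\}$ and $\max\{|f(u)| : u\in A^\theta\}$. The dill map is uniform if these two are equal, i.e. $|f(u)|$ is the same for all $u\in A^\theta$. A cellular automaton over $A^{\mathbb N}$ with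 diameter $\theta$ is a map $F:A^{\mathbb N}\to A^{\mathbb N}$ for which there is a map $g:A^\theta\to A$ with $F(x)_i=g(x_{[i,i+\theta)})$ for all $x\in A^{\mathbb N}$ and $i\in\mathbb N$; equivalently, cellular automata are the uniform dill maps having a local rule all of whose values have length $1$. The map $f^*:A^*\to A^*$ is the extension of $f$ to words: $f^*(u)=\lambda$ if $|u|<\theta$, and otherwise $f^*(u)=f(u_{[0,\theta)})\,f(u_{[1,1+\theta)})\cdots f(u_{[|u|-\theta,|u|)})$. For a word $v$, $(f^* )^{-1}(v)=\{u\in A^* : f^*(u)=v\}$. *)

(* Defs.v *)
From mathcomp Require Import all_boot.
From mathcomp Require Import boolp classical_sets functions cardinality.

Set Implicit Arguments.
Unset Strict Implicit.
Unset Printing Implicit Defensive.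

Local Open Scope classical_set_scope.

Definition config (A : Type) := nat -> A.

Definition window (A : Type) (n : nat) (x : config A) (i : nat) : n.-tuple A :=
  [tuple x (i + j) | j < n].
Arguments window {A} n x i.

(* [y] is the infinite concatenation [w 0 ++ w 1 ++ w 2 ++ ...]. The second
   clause rules out the case where that concatenation is only a finite word. *)
Definition infinite_concat (A : Type) (w : nat -> seq A) (y : config A) : Prop :=
  (forall n, flatten (mkseq w n) = mkseq y (size (flatten (mkseq w n)))) /\
  (forall m, exists n, m <= size (flatten (mkseq w n))).

Definition dill_map (A : finType) (theta : nat) (f : theta.-tuple A -> seq A)
    (F : config A -> config A) : Prop :=
  0 < theta /\
  forall x, infinite_concat (fun i => f (window theta x i)) (F x).

Definition uniform_rule (A : finType) (theta : nat)
    (f : theta.-tuple A -> seq A) : Prop :=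
  forall u v, size (f u) = size (f v).

Definition cellular_automaton (A : finType) (F : config A -> config A) : Prop :=
  exists theta : nat, 0 < theta /\
  exists g : theta.-tuple A -> A, forall x i, F x i = g (window theta x i).

(* The factor [take theta (drop i u)] has length [theta] for every listed [i],
   so [insub] turns it into a tuple and the default [[::]] is never used. *)
Definition extension (A : finType) (theta : nat) (f : theta.-tuple A -> seq A)
    (u : seq A) : seq A :=
  if size u < theta then [::]
  else flatten [seq oapp f [::] (insub (take theta (drop i u)))
               | i <- iota 0 (size u - theta).+1].

(* Main.v *)
Require Import Defs.
From mathcomp Require Import all_boot.
From mathcomp Require Import zify.
From mathcomp Require Import boolp classical_sets functions cardinality.

(** Write [k] for the number of letters and [theta = t + 1].

    Length of the local rule. If every [f u] has length [c], the first
    [c * n] letters of [F x] depend only on the first [n + t] letters of [x].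
    When [F] is onto, all [k ^ (c * n)] words of length [c * n] therefore come
    from at most [k ^ (n + t)] words; with [n = t + 1] this forces [c <= 1],
    and [c = 0] is excluded because [F x] is infinite
    ([uniform_surjective_size1]). So [F] is a cellular automaton, given on
    words by sliding a rule with values in [A] along its argument.

    Balance ([num_preimages_balanced]). Let [N v] be the number of words
    of length [size v + t] mapped to [v]; a nonempty [v] has no preimages of
    another length. Surjectivity gives [0 < N v]. Let [p] be the least value of
    [N], reached at [v]. The sum of [N (v ++ w)] over the [w] of length [j] is
    [k ^ j * N v], so by minimality each term equals [p]: the minimum persists
    on all extensions of [v]. On the other hand the sum of
    [N (v ++ w ++ v)] over the [w] of length [t] is [N v ^ 2], since a preimage of such a word is two independent preimages of
    [v] side by side. Hence [k ^ t * p = p ^ 2], that is [p = k ^ t]. This is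
    also the value of [N] at the empty word, and extending the empty word shows
    that [N] is constant.

    Converse ([preimages_surjective]). If every nonempty word has a preimage,
    the words mapped to prefixes of a given [y] form an infinite, finitely
    branching tree, and an infinite branch is a configuration mapped to [y]. *)

Set Implicit Arguments.
Unset Strict Implicit.

Local Open Scope classical_set_scope.
Local Open Scope card_scope.

(** * Sliding a rule along a word *)

(** The rule is a function on all words, although it only ever reads words of
    length [t.+1]: this keeps windows out of dependent types. The window
    length is a successor, so that the truncated [size u - t] is the number of
    windows even when [u] is too short to contain one. *)
Definition slide {A : Type} (t : nat) (g : seq A -> A) (u : seq A) : seq A :=
  [seq g (take t.+1 (drop i u)) | i <- iota 0 (size u - t)].

Lemma size_slide {A : Type} t (g : seq A -> A) u :
  size (slide t g u) = size u - t.
Proof. by rewrite size_map size_iota. Qed.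

Lemma slide_take {A : Type} t (g : seq A -> A) n u :
  slide t g (take (n + t) u) = take n (slide t g u).
Proof.
rewrite /slide -map_take take_iota size_take_min.
have -> : minn (n + t) (size u) - t = minn n (size u - t) by lia.
apply/eq_in_map => i; rewrite mem_iota add0n leq_min => /andP[_ /andP[ltin _]].
have -> : n + t = (n + t - i) + i by lia.
by rewrite -take_drop take_takel //; lia.
Qed.

Lemma slide_drop {A : Type} t (g : seq A -> A) n u :
  slide t g (drop n u) = drop n (slide t g u).
Proof.
rewrite /slide -map_drop drop_iota size_drop addnC iotaDl -map_comp subnAC.
by apply: eq_map => i /=; rewrite drop_drop addnC.
Qed.

(** * Counting words *)

Definition num_words (A : finType) (n : nat) (P : pred (seq A)) : nat :=
  #|[pred u : n.-tuple A | P u]|.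

Lemma num_words_cat (A : finType) m n (P Q : pred (seq A)) :
  num_words (m + n) (fun u => P (take m u) && Q (drop m u)) =
  num_words m P * num_words n Q.
Proof.
rewrite /num_words -cardX.
pose h (z : m.-tuple A * n.-tuple A) := cat_tuple z.1 z.2.
have h_inj : injective h.
  move=> [a b] [c d] /(congr1 val) /eqP /=.
  by rewrite eqseq_cat ?size_tuple // => /andP[/eqP/val_inj-> /eqP/val_inj->].
rewrite -(fintype.card_image h_inj); apply: eq_card => u.
apply/idP/fintype.imageP => [/andP[Pu Qu]|[[a b] /andP[Pa Qb] ->]]; last first.
  by rewrite !inE /= take_size_cat ?drop_size_cat ?size_tuple //; apply/andP.
have sm : size (take m u) == m by rewrite size_takel // size_tuple leq_addr.
have sn : size (drop m u) == n by rewrite size_drop size_tuple addKn.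
exists (Tuple sm, Tuple sn); first by rewrite !inE /= Pu.
by apply: val_inj; rewrite /= cat_take_drop.
Qed.

Lemma num_words_true (A : finType) n : @num_words A n xpredT = #|A| ^ n.
Proof. by rewrite /num_words -card_tuple; apply: eq_card. Qed.

Lemma num_words_fibers (A : finType) m j (h : seq A -> seq A)
    (P : pred (seq A)) :
    (forall u, size u = m -> P u -> size (h u) = j) ->
  num_words m P =
  \sum_(w : j.-tuple A) num_words m (fun u => P u && (h u == w)).
Proof.
move=> szh; rewrite /num_words -sum1_card.
(* [insubd] below needs a default; without a [w], no [u] satisfies [P]. *)
have [/eqP|A_gt0] := posnP #|{: j.-tuple A}|.
  move=> /eqP T0; rewrite !big1 // => [w|u Pu].
    by have := card0_eq T0 w.
  have su : size (h u) == j by rewrite szh ?size_tuple.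
  by have := card0_eq T0 (Tuple su).
have [w0 _] := card_gt0P A_gt0.
rewrite (partition_big (fun u : m.-tuple A => insubd w0 (h u)) predT) //=.
apply: eq_bigr => w _; rewrite -sum1_card; apply: eq_bigl => u.
rewrite !inE -val_eqE val_insubd; case Pu: (P u) => //=.
by rewrite szh ?size_tuple ?eqxx.
Qed.

(** * Balance of the numbers of preimages *)

Definition num_preimages {A : finType} t (g : seq A -> A) (v : seq A) : nat :=
  num_words (size v + t) (fun u => slide t g u == v).

(** A word whose image extends [v] by [j] letters is a preimage of [v] followed
    by [j] arbitrary letters. *)
Lemma sum_num_preimages_cat {A : finType} t (g : seq A -> A) v j :
  \sum_(w : j.-tuple A) num_preimages t g (v ++ w) =
  num_preimages t g v * #|A| ^ j.
Proof.
set n := size v.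
rewrite -num_words_true /num_preimages -num_words_cat addnAC.
rewrite (@num_words_fibers _ _ j (fun u => drop n (slide t g u))); last first.
  by move=> u su _; rewrite size_drop size_slide su addnK addKn.
apply: eq_bigr => w _; rewrite /num_words size_cat size_tuple.
apply: eq_card => u; rewrite !inE andbT slide_take.
rewrite -{1}(cat_take_drop n (slide t g u)) eqseq_cat //.
by rewrite size_takel // size_slide size_tuple -/n; lia.
Qed.

(** With exactly [t] letters between the two copies of [v], the windows
    producing the first copy and those producing the second one read disjoint
    halves of the preimage, and the halves can be chosen independently. *)
Lemma sum_num_preimages_sandwich {A : finType} t (g : seq A -> A) v :
  \sum_(w : t.-tuple A) num_preimages t g (v ++ w ++ v) =
  num_preimages t g v ^ 2.
Proof.
set n := size v.
rewrite -mulnn /num_preimages -num_words_cat.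
pose middle u := take t (drop n (slide t g u)).
rewrite (@num_words_fibers _ _ t middle) /middle; last first.
  by move=> u su _; rewrite size_takel // size_drop size_slide su -/n; lia.
apply: eq_bigr => w _; rewrite /num_words !size_cat size_tuple -/n.
rewrite (_ : n + (t + n) + t = n + t + (n + t)); last by lia.
apply: eq_card => u; rewrite !inE slide_take slide_drop.
have su : size (slide t g u) = n + (t + n).
  by rewrite size_slide size_tuple; lia.
rewrite -{1}(cat_take_drop n (slide t g u)) eqseq_cat; last first.
  by rewrite size_takel // su leq_addr.
rewrite -{1}(cat_take_drop t (drop n (slide t g u))) eqseq_cat; last first.
  by rewrite (size_tuple w) size_takel // size_drop su; lia.
by rewrite drop_drop (addnC t) -andbA [X in _ && X]andbC.
Qed.

Lemma sum_eq_lower_bound (T : finType) (F : T -> nat) p :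
    (forall x, p <= F x) -> \sum_x F x = p * #|T| ->
  forall x, F x = p.
Proof.
move=> leF sumF x; apply/eqP; rewrite eqn_leq leF andbT.
have: \sum_(y | y != x) p <= \sum_(y | y != x) F y by apply: leq_sum.
move: sumF; rewrite mulnC -sum_nat_const (bigD1 x) //= [in RHS](bigD1 x) //=.
lia.
Qed.

(** The least number [p] of preimages is inherited by all extensions of a word
    reaching it, so sandwiching that word gives [#|A| ^ t * p = p ^ 2]; the
    empty word has [#|A| ^ t] preimages, hence it reaches the minimum too. *)
Lemma num_preimages_balanced (A : finType) t (g : seq A -> A) :
    (forall v, 0 < num_preimages t g v) ->
  forall v, num_preimages t g v = #|A| ^ t.
Proof.
move=> pos.
pose attained p := `[< exists v, num_preimages t g v = p >].
have ex : exists p, attained p.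
  by exists (num_preimages t g [::]); apply/asboolP; exists [::].
have [p /asboolP[v0 v0p] pmin] := ex_minnP ex.
have minp v : p <= num_preimages t g v by apply/pmin/asboolP; exists v.
have ext v w : num_preimages t g v = p -> num_preimages t g (v ++ w) = p.
  move=> vp; have := sum_num_preimages_cat t g v (size w).
  rewrite vp -card_tuple => /(sum_eq_lower_bound (fun _ => minp _)).
  by move=> /(_ (in_tuple w)).
have pE : p = #|A| ^ t.
  have := sum_num_preimages_sandwich t g v0.
  rewrite (eq_bigr (fun=> p)) => [|w _]; last exact: ext.
  rewrite sum_nat_const card_tuple v0p -mulnn => /eqP.
  by rewrite eqn_pmul2r -?v0p // v0p => /eqP.
move=> v; rewrite -pE; apply: (ext [::] v).
by rewrite /num_preimages add0n pE -num_words_true; apply: eq_card => u;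
  rewrite !inE -size_eq0 size_slide size_tuple subnn.
Qed.

(** * An infinite branch of a finitely branching tree *)

(** Koenig's lemma. The branch follows words that have extensions of every
    length in [P]: if all one-letter extensions of a word [u] failed to have
    this property, the largest of the finitely many lengths at which they fail
    would bound the extensions of [u]. *)
Lemma infinite_branch {A : finType} (P : seq A -> Prop) :
    (forall u w, P (u ++ w) -> P u) ->
    (forall n, exists2 u, size u = n & P u) ->
  exists x : config A, forall n, P (mkseq x n).
Proof.
move=> Pcat Plong.
pose deep u := forall n, exists2 w, size w = n & P (u ++ w).
have deep_step u : deep u -> exists a, deep (rcons u a).
  move=> du; apply: contrapT => /forallNP nodeep.
  have /choice[N badN] : forall a, exists n,
      ~ exists2 w, size w = n & P (rcons u a ++ w).
    by move=> a; apply/existsNP; exact: nodeep.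
  have [[//|a w] [szw] Pw] := du (\max_a N a).+1.
  apply: (badN a); exists (take (N a) w).
    by rewrite size_takel // szw; exact: leq_bigmax.
  by apply: (Pcat _ (drop (N a) w)); rewrite -catA cat_take_drop cat_rcons.
have deep0 : deep [::] by move=> n; exact: Plong.
pose node := {u | deep u}.
have /choice[next nextP] : forall v : node,
    exists v' : node, exists a, sval v' = rcons (sval v) a.
  by move=> [u du]; have [a da] := deep_step u du; exists (exist _ _ da), a.
have [label labelP] := choice nextP.
pose x n := label (iter n next (exist _ _ deep0)).
have xE n : sval (iter n next (exist _ _ deep0)) = mkseq x n.
  by elim: n => //= n IH; rewrite labelP IH -mkseqS.
exists x => n; rewrite -xE; case: (iter _ _ _) => u /= /(_ 0)[w _].
exact: Pcat.
Qed.

(** * Dill maps read on prefixes *)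

Lemma extension_mkseq (A : finType) t (f : t.+1.-tuple A -> seq A) x n :
  extension f (mkseq x (n + t)) =
  flatten (mkseq (fun i => f (window t.+1 x i)) n).
Proof.
rewrite /extension size_mkseq; case: n => [|n]; first by rewrite ltnSn.
case: ltnP => [|_]; first by lia.
rewrite addSnnS addnK /mkseq; congr (flatten _); apply/eq_in_map => i.
rewrite -/(mkseq x _) mem_iota => /andP[_ ltin] /=.
have -> : take t.+1 (drop i (mkseq x (n + t.+1))) = window t.+1 x i.
  apply: (@eq_from_nth _ (x 0)) => [|j].
    by rewrite size_tuple size_takel // size_drop size_mkseq; lia.
  rewrite size_takel ?size_drop ?size_mkseq => [ltjt|]; last by lia.
  rewrite nth_take // nth_drop nth_mkseq; last by lia.
  by rewrite (nth_map ord0) ?size_enum_ord // nth_enum_ord.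
by rewrite valK.
Qed.

Lemma extension_dill_map (A : finType) t (f : t.+1.-tuple A -> seq A) F x n :
  dill_map f F ->
  extension f (mkseq x (n + t)) =
  mkseq (F x) (size (extension f (mkseq x (n + t)))).
Proof. by move=> [_ /(_ x)[FE _]]; rewrite extension_mkseq; exact: FE. Qed.

(** The letter [a0] is only a default: it is never reached when all values of
    [f] have length 1 and the argument has length [t.+1]. *)
Definition letter_rule {A : finType} {t} (a0 : A) (f : t.+1.-tuple A -> seq A)
    (s : seq A) : A := head a0 (oapp f [::] (insub s)).

Lemma extension_slide (A : finType) t (f : t.+1.-tuple A -> seq A) a0 u :
    (forall w, size (f w) = 1) ->
  extension f u = slide t (letter_rule a0 f) u.
Proof.
move=> f1; rewrite /extension /slide ltnS.
case: leqP => [|ltu]; first by rewrite -subn_eq0 => /eqP->.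
rewrite -subSn ?subSS //.
rewrite -[RHS]flatten_seq1 -map_comp; congr flatten.
apply/eq_in_map => i; rewrite mem_iota => /andP[_ lti] /=.
have sw : size (take t.+1 (drop i u)) == t.+1.
  by rewrite size_takel // size_drop; lia.
rewrite /letter_rule insubT /=.
by case: (f _) (f1 (Tuple sw)) => [|a []].
Qed.

(** The words of length [t.+1 * c] are all images of words of length
    [t.+1 + t], and [t.+1 * c <= t.+1 + t] leaves only [c <= 1]. *)
Lemma uniform_surjective_size1 (A : finType) t (f : t.+1.-tuple A -> seq A) F :
    1 < #|A| -> dill_map f F -> uniform_rule f ->
    set_surj [set: config A] [set: config A] F ->
  forall u, size (f u) = 1.
Proof.
move=> A_gt1 dF uf surjF u.
have [a0 _] : exists a : A, a \in A by apply/card_gt0P/ltnW.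
have size_ext x n : size (extension f (mkseq x (n + t))) = n * size (f u).
  rewrite extension_mkseq size_flatten /shape -map_comp.
  rewrite (eq_map (g := fun=> size (f u))) => [|i]; last exact: uf.
  rewrite sumnE big_map big_const_seq count_predT size_iota iter_addn_0.
  exact: mulnC.
have c_gt0 : 0 < size (f u).
  case: dF => _ /(_ (fun=> a0))[_ /(_ 1)[n]].
  by rewrite -extension_mkseq size_ext; case: size => //; rewrite muln0.
apply/eqP; rewrite eqn_leq c_gt0 andbT.
set c := size (f u) in size_ext c_gt0 *.
have szE (w : (t.+1 + t).-tuple A) : size (extension f w) == t.+1 * c.
  rewrite -(size_ext (nth a0 w)) (_ : mkseq (nth a0 w) _ = w) //.
  by rewrite -[X in mkseq _ X](size_tuple w) mkseq_nth.
have img (v : (t.+1 * c).-tuple A) : v \in codom (fun w => Tuple (szE w)).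
  have [x _ Fx] := surjF (nth a0 v) I.
  have sx : size (mkseq x (t.+1 + t)) == t.+1 + t by rewrite size_mkseq.
  apply/codomP; exists (Tuple sx); apply: val_inj => /=.
  rewrite (extension_dill_map _ _ dF) Fx size_ext.
  by rewrite -[X in mkseq _ X](size_tuple v) mkseq_nth.
have : #|{: (t.+1 * c).-tuple A}| <= #|{: (t.+1 + t).-tuple A}|.
  apply: leq_trans (leq_image_card (fun w => Tuple (szE w)) predT).
  by apply/subset_leq_card/fintype.subsetP => v _; exact: img.
rewrite !card_tuple leq_exp2l //; nia.
Qed.

Lemma slide_prefix (A : finType) t (f : t.+1.-tuple A -> seq A) F (a0 : A) x n :
    (forall u, size (f u) = 1) -> dill_map f F ->
  slide t (letter_rule a0 f) (mkseq x (n + t)) = mkseq (F x) n.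
Proof.
move=> f1 dF; rewrite -extension_slide // (extension_dill_map _ _ dF).
by rewrite (extension_slide a0) // size_slide size_mkseq addnK.
Qed.

Lemma size1_cellular_automaton (A : finType) t (f : t.+1.-tuple A -> seq A) F :
    A -> (forall u, size (f u) = 1) -> dill_map f F ->
  cellular_automaton F.
Proof.
move=> a0 f1 dF; exists t.+1; split=> //.
exists (fun w => head a0 (f w)) => x i.
have [_ /(_ x)[/(_ i.+1) FE _]] := dF.
have fE w : f w = [:: head a0 (f w)] by case: (f w) (f1 w) => [|a []].
move: FE; rewrite (eq_mkseq (fun j => fE (window t.+1 x j))).
rewrite [flatten _]flatten_map1 size_map size_iota => /(congr1 (nth a0 ^~ i)).
by rewrite (nth_map 0) ?size_iota // nth_iota // nth_mkseq // => ->.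
Qed.

(** * Surjectivity and preimages of words *)

Lemma surjective_num_preimages_gt0 (A : finType) t
    (f : t.+1.-tuple A -> seq A) F (a0 : A) :
    (forall u, size (f u) = 1) -> dill_map f F ->
    set_surj [set: config A] [set: config A] F ->
  forall v, 0 < num_preimages t (letter_rule a0 f) v.
Proof.
move=> f1 dF surjF v; have [x _ Fx] := surjF (nth a0 v) I.
have sx : size (mkseq x (size v + t)) == size v + t by rewrite size_mkseq.
apply/card_gt0P; exists (Tuple sx).
by rewrite !inE /= (slide_prefix _ _ _ f1 dF) Fx mkseq_nth.
Qed.

Lemma card_eq_uniq_seq {T : eqType} (s : seq T) :
  uniq s -> [set x | x \in s] #= `I_(size s).
Proof.
case: s => [_|x0 s us]; first by rewrite II0 card_eq0; apply/eqP/seteqP; split.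
set r := x0 :: s in us *.
rewrite (_ : [set x | _] = nth x0 r @` `I_(size r)); last first.
  apply/seteqP; split=> [x /= xr|_ [i /= ltir <-]]; last exact: mem_nth.
  by exists (index x r); [rewrite -index_mem in xr | exact: nth_index].
apply: inj_card_eq => i j; rewrite !inE => lti ltj /eqP.
by rewrite nth_uniq // => /eqP.
Qed.

(** A nonempty [v] fixes the length of its preimages; the empty word does not,
    since every word of length at most [t] is mapped to it. *)
Lemma card_preimages {A : finType} t (g : seq A -> A) v :
    v <> [::] ->
  [set u | slide t g u = v] #= `I_(num_preimages t g v).
Proof.
move=> v_neq0.
pose pre := [pred u : (size v + t).-tuple A | slide t g u == v].
pose s := [seq val u | u <- enum pre].
rewrite (_ : num_preimages t g v = size s); last by rewrite size_map -cardE.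
rewrite (_ : [set u | _] = [set u | u \in s]); last first.
  apply/seteqP; split=> [u /= uv|_ /= /mapP[u + ->]]; last first.
    by rewrite mem_enum inE => /eqP.
  have v_gt0 : 0 < size v by case: (v) v_neq0.
  have su : size u == size v + t.
    by move: v_gt0; rewrite -uv size_slide subn_gt0 => /ltnW tu; rewrite subnK.
  by apply/mapP; exists (Tuple su) => //; rewrite mem_enum inE /= uv.
apply: card_eq_uniq_seq; rewrite map_inj_uniq ?enum_uniq //; exact: val_inj.
Qed.

(** Compactness: a configuration mapped to [y] is an infinite branch of the
    tree of words whose image is a prefix of [y]. *)
Lemma preimages_surjective (A : finType) t
    (f : t.+1.-tuple A -> seq A) F (a0 : A) :
    (forall u, size (f u) = 1) -> dill_map f F ->
    (forall v, v <> [::] -> exists u, extension f u = v) ->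
  set_surj [set: config A] [set: config A] F.
Proof.
move=> f1 dF pre y _; pose g := letter_rule a0 f.
have prefix_closed u m k : slide t g u = mkseq y k ->
    slide t g (take m u) = mkseq y (size (take m u) - t).
  move=> uy; have szu : size u - t = k.
    by rewrite -(size_slide t g) uy size_mkseq.
  have [tm|/ltnW mt] := leqP t m; last first.
    have : size (take m u) <= t by rewrite size_take_min geq_min mt.
    by rewrite -subn_eq0 /slide => /eqP->.
  rewrite -(subnK tm) slide_take uy /mkseq -map_take take_iota size_take_min.
  by congr (map _ (iota _ _)); lia.
pose into_y u := slide t g u = mkseq y (size u - t).
have [||x xP] := @infinite_branch A into_y.
- by move=> u w /(prefix_closed _ (size u)); rewrite take_size_cat.
- (* The index [n.+1] makes the target nonempty, hence its preimage has length
     [n.+1 + t], enough for a prefix of length [n]. *)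
  move=> n; have [|u] := pre (mkseq y n.+1); first by [].
  rewrite (extension_slide a0) // -/g => uy; exists (take n u).
    have := congr1 size uy; rewrite size_slide size_mkseq size_take_min; lia.
  exact: prefix_closed uy.
exists x => //; apply/funext => i.
have := xP (i.+1 + t); rewrite /into_y.
rewrite (slide_prefix _ _ _ f1 dF) size_mkseq addnK.
by move=> /(congr1 (nth a0 ^~ i)); rewrite !nth_mkseq.
Qed.

(** * The equivalence *)

Theorem theorem2 (A : finType) (hA : 1 < #|A|) (theta : nat)
    (f : theta.-tuple A -> seq A) (F : config A -> config A)
    (hF : dill_map f F) (hf : uniform_rule f) :
  [<-> set_surj [set: config A] [set: config A] F;
       cellular_automaton F /\ set_surj [set: config A] [set: config A] F;
       (forall u : theta.-tuple A, size (f u) = 1) /\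
       (forall v : seq A, v <> [::] ->
          [set u : seq A | extension f u = v] #= `I_(#|A| ^ (theta - 1)))].
Proof.
have [a0 _] : exists a : A, a \in A by apply/card_gt0P/ltnW.
case: theta f hF hf => [|t] f hF hf; first by case: hF.
rewrite subn1 /=; tfae.
- move=> surjF; split=> //; apply: (size1_cellular_automaton a0 _ hF).
  exact: uniform_surjective_size1 hA hF hf surjF.
- move=> [_ surjF].
  have f1 := uniform_surjective_size1 hA hF hf surjF.
  split=> // v v_neq0.
  have pos := surjective_num_preimages_gt0 a0 f1 hF surjF.
  rewrite -(num_preimages_balanced pos v).
  rewrite (_ : [set u | _] = [set u | slide t (letter_rule a0 f) u = v]).
    exact: card_preimages.
  by apply/funext => u /=; rewrite -extension_slide.
- move=> [f1 card_pre]; apply: (preimages_surjective a0 f1 hF) => v v_neq0.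
  apply: contrapT => no_pre; have := card_pre v v_neq0.
  rewrite (_ : [set u | _] = set0); last first.
    by apply/seteqP; split=> // u uv; case: no_pre; exists u.
  rewrite card_eq_sym card_eq0 => /eqP I0.
  have : `I_(#|A| ^ t) 0 by rewrite /= expn_gt0 ltnW.
  by rewrite I0.
Qed.
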